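(* Let $n\ge 2$ and let $G_1,G_2$ be proper convex subdomains of $\mathbb{R}^n$. Let $L\ge 1$ and let $f:G_1\to G_2=f(G_1)$ be an $L$-bilipschitz map with respect to the visual angle metric, i.e. $f$ is a homeomorphism and $v_{G_1}(x,y)/L\le v_{G_2}(f(x),f(y))\le L\,v_{G_1}(x,y)$ for all $x,y\in G_1$. Then $f$ is quasiconformal, with linear dilatation at most $4L^2$, i.e. $H(x,f)\le 4L^2$ for every $x\in G_1$.
   Context: For a domain $G\subsetneq\mathbb{R}^n$ whose boundary $\partial G$ is not a proper subset of a line, the visual angle metric is $v_G(x,y)=\sup_{z\in\partial G}\measuredangle(x,z,y)$ for $x,y\in G$, where $\measuredangle(x,z,y)\in[0,\pi]$ is the angle at $z$ between the segments $[x,z]$ and $[y,z]$ (so $v_G(x,x)=0$). The linear dilatation of $f:G\to\mathbb{R}^n$ at $x\in G$ is $$H(x,f)=\limsup_{r\to0^+}\frac{L(x,f,r)}{l(x,f,r)},$$ where $L(x,f,r)=\max\{|f(z)-f(x)|:|z-x|=r\}$ and $l(x,f,r)=\min\{|f(z)-f(x)|:|z-x|=r\}$ for $0<r<d(x,\partial G)$. A homeomorphism $f$ between domains of $\mathbb{R}^n$ is quasiconformal if and only if $H(x,f)$ is bounded on its domain (this is the characterization to be used as the definition here; no assumption on orientation is made). *)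

(* Defs.v *)
From mathcomp Require Import all_boot all_order all_algebra.
From mathcomp Require Import all_classical all_reals all_analysis.
Set Implicit Arguments.
Unset Strict Implicit.
Unset Printing Implicit Defensive.
Import Order.TTheory GRing.Theory Num.Theory.
Import numFieldNormedType.Exports.
Local Open Scope classical_set_scope.
Local Open Scope ring_scope.

(* R^n is 'rV[R]_n. The norm `|x| of 'rV[R]_n in the library is the max norm, so
   the Euclidean structure is introduced separately; the library's topology on
   'rV[R]_n is the product topology, i.e. the Euclidean one. *)
Definition dotprod (R : realType) (n : nat) (u v : 'rV[R]_n) : R :=
  \sum_(i < n) u 0 i * v 0 i.

Definition enorm (R : realType) (n : nat) (u : 'rV[R]_n) : R :=
  Num.sqrt (dotprod u u).

Definition domain (R : realType) (n : nat) (G : set 'rV[R]_n) : Prop :=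
  [/\ G !=set0, open G & connected G].

Definition boundary (R : realType) (n : nat) (G : set 'rV[R]_n) : set 'rV[R]_n :=
  closure G `\` interior G.

Definition proper_convex_domain (R : realType) (n : nat) (G : set 'rV[R]_n) :
    Prop :=
  [/\ domain G, G <> setT & convex_set G].

(* Meaningful for x != z and y != z, which holds below since z lies on the
   boundary of an open set containing x and y. *)
Definition angle (R : realType) (n : nat) (x z y : 'rV[R]_n) : R :=
  acos (dotprod (x - z) (y - z) / (enorm (x - z) * enorm (y - z))).

(* Total in G. If G is a nonempty proper open subset of R^n its boundary is
   nonempty, and the angles lie in [0, pi], so this is a genuine supremum. That the
   boundary is not a proper subset of a line makes v_G a metric; this holds
   automatically for proper convex domains when n >= 2. *)
Definition visual_angle (R : realType) (n : nat) (G : set 'rV[R]_n)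
    (x y : 'rV[R]_n) : R :=
  sup [set angle x z y | z in boundary G].

Definition homeomorphism_between (R : realType) (n : nat)
    (G1 G2 : set 'rV[R]_n) (f : 'rV[R]_n -> 'rV[R]_n) : Prop :=
  [/\ set_bij G1 G2 f, {within G1, continuous f} &
      exists g : 'rV[R]_n -> 'rV[R]_n,
        {within G2, continuous g} /\ forall x, G1 x -> g (f x) = x].

Definition visual_angle_bilipschitz (R : realType) (n : nat) (L : R)
    (G1 G2 : set 'rV[R]_n) (f : 'rV[R]_n -> 'rV[R]_n) : Prop :=
  homeomorphism_between G1 G2 f /\
  forall x y, G1 x -> G1 y ->
    visual_angle G1 x y / L <= visual_angle G2 (f x) (f y)
      <= L * visual_angle G1 x y.

Definition image_distances (R : realType) (n : nat)
    (f : 'rV[R]_n -> 'rV[R]_n) (x : 'rV[R]_n) (r : R) : set R :=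
  [set enorm (f z - f x) | z in [set z | enorm (z - x) = r]].

(* For 0 < r < d(x, bd G), with f continuous on G, the sphere of radius r is a
   compact subset of G, so the sup and inf below are a max and a min. *)
Definition max_stretch (R : realType) (n : nat)
    (f : 'rV[R]_n -> 'rV[R]_n) (x : 'rV[R]_n) (r : R) : R :=
  sup (image_distances f x r).

Definition min_stretch (R : realType) (n : nat)
    (f : 'rV[R]_n -> 'rV[R]_n) (x : 'rV[R]_n) (r : R) : R :=
  inf (image_distances f x r).

(* Extended-real valued; only small r > 0 matter, and for these, when f is
   continuous and injective near x, the denominator is positive. *)
Definition linear_dilatation (R : realType) (n : nat)
    (f : 'rV[R]_n -> 'rV[R]_n) (x : 'rV[R]_n) : \bar R :=
  limf_esup (fun r : R => (max_stretch f x r / min_stretch f x r)%:E) 0^'+.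

(* Linear dilatations of injective maps are nonnegative, so boundedness is
   boundedness above by a real number. *)
Definition quasiconformal (R : realType) (n : nat)
    (G1 G2 : set 'rV[R]_n) (f : 'rV[R]_n -> 'rV[R]_n) : Prop :=
  [/\ domain G1, domain G2, homeomorphism_between G1 G2 f &
      exists K : R, forall x, G1 x -> (linear_dilatation f x <= K%:E)%E].

(* Main.v *)
Require Import Defs.
From mathcomp Require Import all_boot all_order all_algebra.
From mathcomp Require Import all_classical all_reals all_analysis.
From mathcomp Require Import ring lra.
Import Order.TTheory GRing.Theory Num.Theory.
Import numFieldNormedType.Exports.
Local Open Scope classical_set_scope.
Local Open Scope ring_scope.

(** In a convex domain the visual angle metric is, infinitesimally, comparable
    to the Euclidean distance divided by the distance to the boundary, and the
    ratio of the two comparison constants is 2.  Write d for the distance from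
    x to the boundary of G and r = |x - y|.

    From above, the segment from x to y is seen from a boundary point z, at
    distance at least d from x, under an angle whose sine is at most r / d.
    Since t cos t <= sin t, this gives v_G(x,y) <= r / (d - r) when r < d
    ([visual_angle_le]).

    From below, let e be the unit vector from x to a nearest boundary point.
    By convexity G lies in the half-space of the q with <q - x, e> <= d
    ([exists_supported_at]).  In a half-space, the best boundary point for y near x
    lies on the ray from x that bisects e and the direction orthogonal to y - x
    in the plane of e and y - x.  The constant 2 is already reached with any
    unit vector p orthogonal to y - x such that <p, e> >= 0.  Follow the ray
    from x in the direction e + p: it leaves G no later than it leaves the
    half-space, and the boundary point met there sees x and y under an angle at
    least r / (2 (d + r)) ([visual_angle_ge]).

    Now let f be L-bilipschitz, let d1, d2 be the distances to the boundary of
    x and f x, and let |z - x| = r, |f z - f x| = s be small.  Chaining the two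
    bounds in G1 and G2 through the bilipschitz inequalities gives, up to
    factors tending to 1,
      s <= 2 L (d2 / d1) r   and   r <= 2 L (d1 / d2) s.
    The two inequalities are one lemma, [displacement_le], applied to f and to
    its inverse.  The unknown ratio d2 / d1 cancels in the quotient of the
    largest by the smallest s, which is thus at most (2 L)^2 in the limit. *)

(** * Euclidean inner product and norm *)

Section Euclid.
Context {R : realType} {n : nat}.
Implicit Types (u v w : 'rV[R]_n) (a : R).

Lemma dotprodC u v : dotprod u v = dotprod v u.
Proof. by apply: eq_bigr => i _; rewrite mulrC. Qed.

Lemma dotprodDl u v w : dotprod (u + v) w = dotprod u w + dotprod v w.
Proof.
by rewrite /dotprod -big_split; apply: eq_bigr => i _; rewrite mxE mulrDl.
Qed.

Lemma dotprodZl a u w : dotprod (a *: u) w = a * dotprod u w.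
Proof.
by rewrite /dotprod mulr_sumr; apply: eq_bigr => i _; rewrite mxE mulrA.
Qed.

Lemma dotprodNl u w : dotprod (- u) w = - dotprod u w.
Proof. by rewrite -scaleN1r dotprodZl mulN1r. Qed.

Lemma dotprodDr u v w : dotprod w (u + v) = dotprod w u + dotprod w v.
Proof. by rewrite !(dotprodC w) dotprodDl. Qed.

Lemma dotprodZr a u w : dotprod w (a *: u) = a * dotprod w u.
Proof. by rewrite !(dotprodC w) dotprodZl. Qed.

Lemma dotprodNr u w : dotprod w (- u) = - dotprod w u.
Proof. by rewrite !(dotprodC w) dotprodNl. Qed.

Definition dotprodE := (dotprodDl, dotprodDr, dotprodZl, dotprodZr,
  dotprodNl, dotprodNr).

Lemma dotprod_sqrD u v :
  dotprod (u + v) (u + v) = dotprod u u + 2 * dotprod u v + dotprod v v.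
Proof. by rewrite !dotprodE (dotprodC v u); ring. Qed.

Lemma dotprod_ge0 u : 0 <= dotprod u u.
Proof. by apply: sumr_ge0 => i _; rewrite -expr2 sqr_ge0. Qed.

Lemma dotprod_eq0 u : (dotprod u u == 0) = (u == 0).
Proof.
apply/idP/eqP => [|->]; last first.
  by apply/eqP; apply: big1 => i _; rewrite mxE mul0r.
rewrite psumr_eq0 => [/allP u0|i _]; last by rewrite -expr2 sqr_ge0.
apply/rowP => i; rewrite mxE; apply/eqP.
by have := u0 i (mem_index_enum i); rewrite -expr2 sqrf_eq0.
Qed.

Lemma enorm_ge0 u : 0 <= enorm u.
Proof. exact: sqrtr_ge0. Qed.

Lemma sqr_enorm u : enorm u ^+ 2 = dotprod u u.
Proof. by rewrite sqr_sqrtr ?dotprod_ge0. Qed.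

Lemma enorm_gt0 u : (0 < enorm u) = (u != 0).
Proof. by rewrite sqrtr_gt0 lt_neqAle eq_sym dotprod_eq0 dotprod_ge0 andbT. Qed.

Lemma enormN u : enorm (- u) = enorm u.
Proof. by rewrite /enorm !dotprodE opprK. Qed.

Lemma enormB u v : enorm (u - v) = enorm (v - u).
Proof. by rewrite -enormN opprB. Qed.

(** The squared norm of <v,v> u - <u,v> v is <v,v> times the difference of the
    two sides. *)
Lemma cauchy_schwarz u v : dotprod u v ^+ 2 <= dotprod u u * dotprod v v.
Proof.
have [->|v0] := eqVneq v 0.
  by rewrite -(scale0r 0) !dotprodE !mul0r expr0n mulr0.
have v1 : 0 < dotprod v v.
  by rewrite lt_neqAle eq_sym dotprod_eq0 v0 dotprod_ge0.
rewrite -subr_ge0 -(pmulr_rge0 _ v1).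
have := dotprod_ge0 (dotprod v v *: u - dotprod u v *: v).
rewrite !dotprodE (dotprodC v u); congr (0 <= _); ring.
Qed.

Lemma dotprod_le u v : dotprod u v <= enorm u * enorm v.
Proof.
rewrite -sqrtrM ?dotprod_ge0 //; apply: le_trans (ler_norm _) _.
by rewrite -sqrtr_sqr ler_wsqrtr // cauchy_schwarz.
Qed.

Lemma continuous_enorm : continuous (@enorm R n).
Proof.
move=> u; apply: continuous_comp; last exact: sqrt_continuous.
apply: (@cvg_big R _ _ _ _ _ _ (nbhs u)) => [|i _].
  exact: add_continuous.
by apply: cvgM; exact: coord_continuous.
Qed.

(** Transfers boundedness and neighbourhoods from the Euclidean norm to the max
    norm, which defines the topology of the space of row vectors. *)
Lemma mx_norm_le_enorm u : `|u| <= enorm u.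
Proof.
have -> : `|u| = mx_norm u by [].
rewrite mx_normrE; apply/bigmax_leP; split=> [|[i j] _ /=].
  exact: enorm_ge0.
rewrite -sqrtr_sqr ler_wsqrtr // (ord1 i) expr2 /dotprod (bigD1 j) //= lerDl.
by apply: sumr_ge0 => k _; rewrite -expr2 sqr_ge0.
Qed.

End Euclid.

(** * Comparing an angle with its sine *)

Section Trig.
Context {R : realType}.
Implicit Types c t : R.

Lemma sin_le_id t : 0 <= t -> sin t <= t.
Proof.
move=> t0; rewrite -subr_ge0.
have -> : 0 = 0 - sin 0 :> R by rewrite sin0 subr0.
have D (s : R) : is_derive s (1 : R) (fun s : R => s - sin s) (1 - cos s).
  by apply: is_derive_eq.
apply: (@ger0_derive1_ndecr R (fun s => s - sin s) 0 t) => // [s _|].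
- by rewrite derive1E derive_val subr_ge0 cos_le1.
- by apply: continuous_subspaceT => r; apply: differentiable_continuous;
    apply/derivable1_diffP.
Qed.

(** The derivative of sin s - s cos s is s sin s, nonnegative on [0, pi]. *)
Lemma mul_cos_le_sin t : 0 <= t <= pi -> t * cos t <= sin t.
Proof.
move=> /andP[t0 tpi]; rewrite -subr_ge0.
have -> : 0 = sin 0 - 0 * cos 0 :> R by rewrite sin0 mul0r subr0.
have D (s : R) :
    is_derive s (1 : R) (fun s : R => sin s - s * cos s) (s * sin s).
  apply: is_derive_eq; rewrite /GRing.scale /=; ring.
apply: (@ger0_derive1_ndecr R (fun s => sin s - s * cos s) 0 t) => // [s|].
- rewrite in_itv /= => /andP[s0 st]; rewrite derive1E derive_val.
  rewrite mulr_ge0 ?sin_ge0_pi ?ltW //=; lra.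
- by apply: continuous_subspaceT => r; apply: differentiable_continuous;
    apply/derivable1_diffP.
Qed.

Lemma sqrt_le_acos c : -1 <= c <= 1 -> Num.sqrt (1 - c ^+ 2) <= acos c.
Proof. by move=> c1; rewrite -sin_acos // sin_le_id // acos_ge0. Qed.

Lemma acos_mul_le_sqrt c : -1 <= c <= 1 -> acos c * c <= Num.sqrt (1 - c ^+ 2).
Proof.
move=> c1; rewrite -sin_acos // -{2}(@acosK R c) ?in_itv //.
by rewrite mul_cos_le_sin // acos_ge0 // acos_lepi.
Qed.

End Trig.

(** * Angles at the boundary: the upper bound *)

Section VisualAngleUpper.
Context {R : realType} {n : nat}.
Implicit Types (u v w x y z : 'rV[R]_n) (a c d k : R).

Lemma cosine_bounds u v : -1 <= dotprod u v / (enorm u * enorm v) <= 1.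
Proof.
have le u' : - dotprod u' v <= enorm u' * enorm v.
  by rewrite -dotprodNl -(enormN u') dotprod_le.
have [uv0|uv0] := eqVneq (enorm u * enorm v) 0.
  by rewrite uv0 invr0 mulr0 lerN10 ler01.
have uv1 : 0 < enorm u * enorm v.
  by rewrite lt_neqAle eq_sym uv0 mulr_ge0 ?enorm_ge0.
rewrite ler_pdivlMr // ler_pdivrMr // mul1r mulN1r dotprod_le andbT.
by rewrite lerNl le.
Qed.

(** A lower bound k on the angle follows from a lower bound on its sine, and the
    Gram determinant of x - z and y - z is the squared sine times the squared
    norms; this form avoids square roots and divisions. *)
Lemma angle_ge x z y k : 0 <= k -> x != z -> y != z ->
  let A := x - z in let B := y - z in
  k ^+ 2 * (dotprod A A * dotprod B B) <=
    dotprod A A * dotprod B B - dotprod A B ^+ 2 ->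
  k <= angle x z y.
Proof.
move=> k0 xz yz A B; set N := dotprod A A * dotprod B B => kAB.
have N0 : 0 < N.
  by rewrite /N -!sqr_enorm mulr_gt0 // exprn_gt0 // enorm_gt0 subr_eq0.
rewrite /angle; apply: le_trans (sqrt_le_acos _ (cosine_bounds A B)).
rewrite -[k]ger0_norm // -sqrtr_sqr ler_wsqrtr //.
rewrite expr_div_n exprMn !sqr_enorm -(ler_pM2r N0) mulrBl mul1r.
by rewrite divfK ?gt_eqF.
Qed.

(** With a = |x - z|, b = |y - z|, r = |x - y| and q the sine of the angle, the law
    of cosines gives a q <= r, since r^2 - (a q)^2 is the square of b - a cos.
    The cosine is at least 1 - q, so t cos t <= sin t bounds the angle t by
    q / (1 - q), hence by r / (d - r). *)
Lemma angle_le x z y d : enorm (x - y) < d -> d <= enorm (x - z) ->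
  angle x z y <= enorm (x - y) / (d - enorm (x - y)).
Proof.
move=> rd da; rewrite /angle.
have := enorm_ge0 (x - y); have := sqr_enorm (x - y).
have -> : x - y = (x - z) - (y - z) by rewrite opprB addrA subrK.
move: rd; have -> : x - y = (x - z) - (y - z) by rewrite opprB addrA subrK.
move: (x - z) (y - z) da => A B da rd.
set r := enorm (A - B); set c := _ / _; set a := enorm A; set b := enorm B.
have c1 : -1 <= c <= 1 by exact: cosine_bounds.
move=> r2 r0; rewrite -/r in rd; rewrite -/a in da.
have a0 : 0 < a by lra.
have b0 : 0 < b.
  rewrite lt_neqAle enorm_ge0 andbT eq_sym; apply/negP => /eqP b0.
  have /eqP B0 : B == 0 by rewrite -[_ == 0]negbK -enorm_gt0 -/b b0 ltxx.
  by move: rd; rewrite /r B0 subr0 -/a ltNge da.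
have dotE : dotprod A B = c * (a * b) by rewrite divfK // mulf_neq0 ?gt_eqF.
have r2E : r ^+ 2 = a ^+ 2 - 2 * (c * (a * b)) + b ^+ 2.
  by rewrite r2 !dotprodE (dotprodC B A) dotE -!sqr_enorm -/a -/b; ring.
(* As r < a, the angle at z is not the largest one of the triangle. *)
have c0 : 0 < c.
  have ra : r ^+ 2 < a ^+ 2 by rewrite ltr_pXn2r ?nnegrE //; lra.
  have : 0 < c * (a * b) by have := sqr_ge0 b; lra.
  by rewrite pmulr_lgt0 // mulr_gt0.
have := acos_mul_le_sqrt _ c1; set q := Num.sqrt _ => acq.
have q0 : 0 <= q := sqrtr_ge0 _.
have q2 : q ^+ 2 = 1 - c ^+ 2.
  by rewrite sqr_sqrtr // subr_ge0 expr_le1 //; lra.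
have aqr : a * q <= r.
  rewrite -(@ler_pXn2r _ 2) ?nnegrE ?mulr_ge0 ?(ltW a0) // exprMn q2 r2E.
  by rewrite -subr_ge0; have := sqr_ge0 (b - a * c); congr (0 <= _); ring.
have dqr : d * q <= r by apply: le_trans aqr; rewrite ler_wpM2r.
have qc : 1 - q <= c by nra.
have t0 : 0 <= acos c by exact: acos_ge0.
by rewrite ler_pdivlMr ?subr_gt0 //; nra.
Qed.

Lemma angle_le_visual_angle (G : set 'rV[R]_n) x y z : boundary G z ->
  angle x z y <= visual_angle G x y.
Proof.
move=> Gz; apply: ub_le_sup; last by exists z.
by exists pi => _ [w _ <-]; apply: acos_lepi; exact: cosine_bounds.
Qed.

Lemma visual_angle_le (G : set 'rV[R]_n) x y d :
  (forall z, boundary G z -> d <= enorm (x - z)) -> enorm (x - y) < d ->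
  visual_angle G x y <= enorm (x - y) / (d - enorm (x - y)).
Proof.
move=> dG rd; rewrite /visual_angle; set S := [set _ | _ in _].
have [->|/set0P S0] := eqVneq S set0.
  by rewrite sup0 divr_ge0 ?enorm_ge0 // subr_ge0 ltW.
by apply: ge_sup => // _ [z Gz <-]; apply: angle_le => //; exact: dG.
Qed.

End VisualAngleUpper.

(** * The lower bound in a domain contained in a half-space *)

Section VisualAngleLower.
Context {R : realType} {n : nat}.
Implicit Types (u v w x y : 'rV[R]_n) (a d : R).

(** A hyperplane through 0 contains a nonzero vector because n >= 2, and the sign
    of that vector is free. *)
Lemma exists_unit_orthogonal v e : (2 <= n)%N ->
  exists p, [/\ dotprod p p = 1, dotprod p v = 0 & 0 <= dotprod p e].
Proof.
move=> n2.
have [u uv u0] : exists2 u, dotprod u v = 0 & u != 0.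
  have : kermx v^T != 0.
    rewrite -mxrank_eq0 mxrank_ker -lt0n subn_gt0.
    by apply: leq_ltn_trans n2; exact: rank_leq_col.
  move=> /rowV0Pn[u /sub_kermxP uv u0]; exists u => //.
  have := congr1 (fun M : 'M[R]_1 => M 0 0) uv; rewrite !mxE => <-.
  by apply: eq_bigr => i _; rewrite mxE.
wlog ue : u uv u0 / 0 <= dotprod u e => [H|].
  have [ue|ue] := leP 0 (dotprod u e); first exact: (H u).
  by apply: (H (- u)); rewrite ?dotprodNl ?uv ?oppr0 ?oppr_eq0 // oppr_ge0 ltW.
have N0 : 0 < enorm u by rewrite enorm_gt0.
exists ((enorm u)^-1 *: u); rewrite !dotprodE uv mulr0; split => //.
  by rewrite -sqr_enorm; field; exact: lt0r_neq0.
by rewrite mulr_ge0 // invr_ge0 ltW.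
Qed.

(** The exit parameter of the ray is the supremum of the parameters t at which
    the point is in G; it is a limit of such t, but it is not one of them because
    G is open. *)
Lemma boundary_on_ray (G : set 'rV[R]_n) x w a : open G -> G x ->
  (forall t, 0 <= t -> G (x + t *: w) -> t <= a) ->
  exists t, [/\ 0 < t, t <= a & boundary G (x + t *: w)].
Proof.
move=> Gopen Gx ha; set S := [set t : R | 0 <= t /\ G (x + t *: w)].
have S0 : S 0 by split; rewrite // scale0r addr0.
have ubS : has_ubound S by exists a => t [t0 Gt]; exact: ha.
have cont t : {for t, continuous (fun s : R => x + s *: w)}.
  apply: continuousD; first exact: cst_continuous.
  exact: scalel_continuous.
have nG : ~ G (x + sup S *: w).
  move=> Gs.
  have : nbhs (sup S) [set s : R | G (x + s *: w)].
    by apply: cont; exact: open_nbhs_nbhs.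
  move=> /nbhs_ballP[e /= e0 be].
  have St : S (sup S + e / 2).
    split; first by rewrite addr_ge0 ?divr_ge0 ?(ltW e0) // (ub_le_sup ubS).
    apply: be; rewrite /ball /= opprD addNKr normrN.
    by rewrite ger0_norm ?divr_ge0 ?(ltW e0) //; lra.
  have := ub_le_sup ubS St; lra.
exists (sup S); split.
- rewrite lt_neqAle (ub_le_sup ubS S0) andbT; apply/eqP => s0; apply: nG.
  by rewrite -s0 scale0r addr0.
- by apply: ge_sup; [exists 0|move=> t [t0 Gt]; exact: ha].
split; last by move=> /interior_subset.
move=> B /cont /(closure_sup (ex_intro _ 0 S0) ubS)[t [[_ Gt] Bt]].
by exists (x + t *: w).
Qed.

(** The boundary point z on the ray from x in the direction e + p sees the segment
    from x to y under an angle that is controlled by the component of z - x along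
    p, which is orthogonal to y - x.  As <p, e> = s >= 0, this component makes up
    a proportion sqrt ((1 + s) / 2) >= 1 / sqrt 2 of |z - x|, while |z - x| is at
    most sqrt 2 times d. *)
Lemma visual_angle_ge (G : set 'rV[R]_n) x y e d : (2 <= n)%N ->
  open G -> G x -> G y -> 0 < d -> dotprod e e = 1 ->
  (forall q, G q -> dotprod (q - x) e <= d) ->
  enorm (x - y) / (2 * (d + enorm (x - y))) <= visual_angle G x y.
Proof.
move=> n2 Gopen Gx Gy d0 e1 supp; set r := enorm (x - y).
have [p [p1 py pe]] := exists_unit_orthogonal (y - x) e n2.
set s := dotprod p e in pe; set w := e + p.
have we : dotprod w e = 1 + s by rewrite dotprodE e1.
have [t [t0 td tG]] : exists t,
    [/\ 0 < t, t <= d / (1 + s) & boundary G (x + t *: w)].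
  apply: boundary_on_ray => // t t0 /supp.
  by rewrite addrC addKr dotprodE we ler_pdivlMr //; lra.
apply: le_trans (angle_le_visual_angle _ _ _ _ tG); set z := x + t *: w in tG *.
have neqz q : G q -> q != z.
  by move=> Gq; apply/eqP => qz; case: tG => _; apply; rewrite -qz; exact: Gopen.
have r0 : 0 <= r by exact: enorm_ge0.
apply: angle_ge; rewrite ?neqz //; first by rewrite divr_ge0 //; lra.
set A := x - z; set C := y - x in py *.
have AE : A = - (t *: w) by rewrite /A /z opprD addrA subrr add0r.
have -> : y - z = C + A by rewrite addrA subrK.
have AA : dotprod A A = 2 * (1 + s) * t ^+ 2.
  by rewrite AE !dotprodE e1 p1 (dotprodC e p) -/s; ring.
have Ap : dotprod A p = - (t * (1 + s)).
  by rewrite AE !dotprodE p1 (dotprodC e p) -/s; ring.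
have CC : dotprod C C = r ^+ 2 by rewrite /r enormB sqr_enorm.
clearbody A C.
(* Bessel's inequality for A and the orthogonal pair p, C: Cauchy-Schwarz
   applied to C and the part of A orthogonal to p. *)
have bessel : dotprod A C ^+ 2 <= (dotprod A A - dotprod A p ^+ 2) * r ^+ 2.
  have := cauchy_schwarz (A - dotprod A p *: p) C.
  rewrite !dotprodE py p1 CC (dotprodC p A) mulr0 subr0.
  by congr (_ <= _ * _); ring.
have tsd : t * (1 + s) <= d by rewrite -ler_pdivlMr //; lra.
have AA_le : dotprod A A <= 2 * d ^+ 2.
  have tled : t <= d by have := mulr_ge0 (ltW t0) pe; lra.
  have : t * (t * (1 + s)) <= d * d.
    by rewrite ler_pM ?mulr_ge0 ?(ltW t0) ?addr_ge0.
  by rewrite AA; lra.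
have BB_le : dotprod (C + A) (C + A) <= 2 * (d + r) ^+ 2.
  have := cauchy_schwarz A C; rewrite CC => cs.
  have ACd : dotprod A C <= 2 * d * r.
    have [ac|ac] := leP (dotprod A C) 0; first by nra.
    rewrite -(@ler_pXn2r _ 2) ?nnegrE //; [nra|exact: ltW|nra].
  by rewrite !dotprodE CC (dotprodC C A); nra.
(* The 4 in the square of r / (2 (d + r)) is split in two: one factor 2 pays for
   <y - z, y - z> <= 2 (d + r)^2, the other for <A, A> <= 2 <A, p>^2. *)
have kr : (r / (2 * (d + r))) ^+ 2 * dotprod (C + A) (C + A) <= r ^+ 2 / 2.
  have -> : r ^+ 2 / 2 = (r / (2 * (d + r))) ^+ 2 * (2 * (d + r) ^+ 2).
    by field; lra.
  by rewrite ler_wpM2l // sqr_ge0.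
have -> : dotprod A A * dotprod (C + A) (C + A) - dotprod A (C + A) ^+ 2
    = dotprod A A * r ^+ 2 - dotprod A C ^+ 2.
  by rewrite !dotprodE CC (dotprodC C A); ring.
have A0 : 0 <= dotprod A A by exact: dotprod_ge0.
have : dotprod A A * r ^+ 2 / 2 <= dotprod A p ^+ 2 * r ^+ 2.
  rewrite mulrAC ler_wpM2r ?sqr_ge0 // AA Ap.
  by have := sqr_ge0 t; nra.
by nra.
Qed.

End VisualAngleLower.

(** * The supporting half-space at a nearest boundary point *)

Section Support.
Context {R : realType} {n : nat}.
Implicit Types (x y z q : 'rV[R]_n) (d k t : R) (G : set 'rV[R]_n).

Lemma convex_set_comb G x y t : convex_set G -> G x -> G y -> 0 <= t <= 1 ->
  G (t *: x + (1 - t) *: y).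
Proof.
move=> cG /mem_set Gx /mem_set Gy t01.
have /set_mem := cG _ _ (Itv01 (proj1 (andP t01)) (proj2 (andP t01))) Gx Gy.
by [].
Qed.

(** For convex G this pins d down as the distance from x to the boundary: d is at
    most that distance, and G lies on one side of a hyperplane at distance d
    from x. *)
Definition supported_at G x d :=
  [/\ 0 < d, forall z, boundary G z -> d <= enorm (x - z) &
    exists2 e, dotprod e e = 1 & forall q, G q -> dotprod (q - x) e <= d].

(** Only the points of F in a closed ball around x compete, and they form a
    compact set. *)
Lemma exists_nearest F x : closed F -> F !=set0 ->
  exists2 z, F z & forall y, F y -> enorm (z - x) <= enorm (y - x).
Proof.
move=> Fcl [y0 Fy0]; set A := F `&` [set y | enorm (y - x) <= enorm (y0 - x)].
have cont : continuous (fun y => enorm (y - x)).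
  move=> y; apply: (@continuous_comp _ _ _ (fun y => y - x)).
    by apply: continuousB; [exact: cvg_id|exact: cst_continuous].
  exact: continuous_enorm.
have [|||z /set_mem[Fz _] zmin] := @EVT_min_rV R n (fun y => enorm (y - x)) A.
- by exists y0; split => /=.
- apply: bounded_closed_compact.
    exists (`|x| + enorm (y0 - x)); split; first exact: num_real.
    move=> M ltM y [_ /= yx]; apply: le_trans (ltW ltM).
    rewrite -{1}(subrK x y) addrC; apply: le_trans (ler_normD _ _) _.
    by rewrite lerD2l; exact: le_trans (mx_norm_le_enorm _) yx.
  apply: closedI => //; apply: (preimage_closed _ (@closed_le R _)).
  by move=> y _; exact: cont.
- exact: continuous_subspaceT.
exists z => // y Fy; have [le|lt] := leP (enorm (y - x)) (enorm (y0 - x)).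
  by apply: zmin; apply/mem_set.
by apply: le_trans (ltW lt); apply: zmin; apply/mem_set; split => /=.
Qed.

(** Let z0 be a nearest point to x outside G and let b = z0 - x, of norm d.  If some
    q in G were strictly beyond the hyperplane through z0 orthogonal to b, then
    moving from z0 away from q would first bring one closer to x, hence inside
    G, and z0 would lie between two points of G. *)
Lemma exists_supported_at G x : proper_convex_domain G -> G x ->
  exists d, supported_at G x d.
Proof.
move=> [[_ Gopen _] GT cG] Gx.
have [z0 nGz0 zmin] : exists2 z, (~` G) z &
    forall y, (~` G) y -> enorm (z - x) <= enorm (y - x).
  apply: exists_nearest; first exact: open_closedC.
  by apply/set0P/eqP => G0; apply: GT; rewrite -(setCK G) G0 setC0.
set b := z0 - x in zmin; set d := enorm b in zmin.
have d0 : 0 < d.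
  by rewrite enorm_gt0 subr_eq0; apply/eqP => zx; apply: nGz0; rewrite zx.
exists d; split => //.
  by move=> z [_ nGz]; rewrite enormB; apply: zmin => Gz; exact/nGz/Gopen.
exists (d^-1 *: b).
  by rewrite dotprodZl dotprodZr -sqr_enorm -/d; field; exact: lt0r_neq0.
move=> q Gq; rewrite dotprodZr mulrC ler_pdivrMr // -expr2 leNgt.
apply/negP => qd; set a := z0 - q.
have bb : dotprod b b = d ^+ 2 by rewrite sqr_enorm.
have ab0 : dotprod a b < 0.
  have -> : a = b - (q - x) by rewrite /a /b opprB addrA subrK.
  rewrite dotprodDl bb dotprodNl; lra.
have aa : 0 < dotprod a a.
  rewrite lt_neqAle dotprod_ge0 andbT eq_sym dotprod_eq0; apply/eqP => a0.
  by move: ab0; rewrite a0 -(scale0r 0) dotprodZl mul0r ltxx.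
(* The minimizer of |b + t a|. *)
set t := - dotprod a b / dotprod a a.
have t0 : 0 < t by rewrite divr_gt0 ?oppr_gt0.
have Gy : G (z0 + t *: a).
  apply: contrapT => /zmin; apply/negP; rewrite -ltNge.
  rewrite -(@ltr_pXn2r _ 2) ?nnegrE ?enorm_ge0 // ?(ltW d0) // sqr_enorm.
  have -> : z0 + t *: a - x = b + t *: a by rewrite addrAC.
  rewrite (dotprod_sqrD b) !dotprodZr dotprodZl bb (dotprodC b a).
  have taa : t * dotprod a a = - dotprod a b.
    by rewrite /t; field; exact: lt0r_neq0.
  by rewrite taa; have := mulr_gt0 t0 (mulr_gt0 t0 aa); rewrite taa; lra.
apply: nGz0.
have t1 : 1 + t != 0 by apply: lt0r_neq0; lra.
have -> : z0 = (1 + t)^-1 *: (z0 + t *: a) + (1 - (1 + t)^-1) *: q.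
  by apply/rowP => i; rewrite !mxE; field.
apply: convex_set_comb => //; rewrite invr_ge0 invf_le1; lra.
Qed.

End Support.

(** * Linear dilatation *)

Section Dilatation.
Context {R : realType} {n : nat}.
Implicit Types (x y : 'rV[R]_n) (c d k r t : R) (G : set 'rV[R]_n).

(** The lower bound of the visual angle in G' and the upper bound in G, linked by
    one of the two bilipschitz inequalities.  Taking displacements at most k
    times the distances to the boundary replaces the error terms of these
    bounds by the factor (1 + k) / (1 - k). *)
Lemma displacement_le G G' x y x' y' d d' k L : (2 <= n)%N ->
  open G' -> G' x' -> G' y' -> supported_at G x d -> supported_at G' x' d' ->
  0 <= k < 1 -> 0 <= L -> enorm (x - y) <= k * d -> enorm (x' - y') <= k * d' ->
  visual_angle G' x' y' <= L * visual_angle G x y ->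
  enorm (x' - y') <= 2 * L * ((1 + k) / (1 - k)) * (d' / d) * enorm (x - y).
Proof.
move=> n2 G'o Gx' Gy' [d0 dG _] [d0' _ [e e1 eG]] /andP[k0 k1] L0 rk rk' vv.
have := visual_angle_ge _ _ _ _ _ n2 G'o Gx' Gy' d0' e1 eG.
have rd : enorm (x - y) < d by apply: le_lt_trans rk _; rewrite gtr_pMl.
have := visual_angle_le _ _ y _ dG rd.
move: (enorm_ge0 (x - y)) (enorm_ge0 (x' - y')) rk rk' rd.
move: (enorm (x - y)) (enorm (x' - y')) => r r' r0 r0' rk rk' rd v_le v_ge.
have kd : 0 < (1 - k) * d by rewrite mulr_gt0 // subr_gt0.
have {}v_le : visual_angle G x y <= r / ((1 - k) * d).
  apply: le_trans v_le _; rewrite ler_wpM2l // lef_pV2 ?posrE //; lra.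
have {}v_ge : r' / (2 * ((1 + k) * d')) <= visual_angle G' x' y'.
  apply: le_trans v_ge; rewrite ler_wpM2l // lef_pV2 ?posrE //; nra.
have := le_trans v_ge (le_trans vv (ler_wpM2l L0 v_le)).
rewrite ler_pdivrMr; last nra.
congr (_ <= _); field; rewrite ?lt0r_neq0 //; lra.
Qed.


(** A linear rate at which the error factor tends to 1 as k tends to 0. *)
Lemma ratio_sqr_le k : 0 <= k <= 4^-1 -> ((1 + k) / (1 - k)) ^+ 2 <= 1 + 16 * k.
Proof.
move=> /andP[k0 k1]; have k2 : 0 < 1 - k by lra.
by rewrite expr_div_n ler_pdivrMr ?exprn_gt0 //; nra.
Qed.

Lemma image_distances_neq0 (f : 'rV[R]_n -> 'rV[R]_n) x (r : R) : (2 <= n)%N ->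
  0 <= r -> image_distances f x r !=set0.
Proof.
move=> n2 r0; have [p [p1 _ _]] := exists_unit_orthogonal (0 : 'rV[R]_n) 0 n2.
exists (enorm (f (x + r *: p) - f x)), (x + r *: p) => //=.
rewrite addrC addKr /enorm dotprodZl dotprodZr p1 mulr1 -expr2 sqrtr_sqr.
by rewrite ger0_norm.
Qed.

(** The sphere must be nonempty for the infimum to inherit the lower bound m. *)
Lemma stretch_ratio_le (f : 'rV[R]_n -> 'rV[R]_n) x (r c m : R) : (2 <= n)%N ->
  0 <= r -> 0 < m -> 0 <= c ->
  (forall z, enorm (z - x) = r -> m <= enorm (f z - f x) <= c * m) ->
  max_stretch f x r / min_stretch f x r <= c.
Proof.
move=> n2 r0 m0 c0 fz; have ne := image_distances_neq0 f x r n2 r0.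
have m_le : m <= min_stretch f x r.
  by apply: lb_le_inf => // _ [z /= zr <-]; have /andP[] := fz z zr.
rewrite ler_pdivrMr; last exact: lt_le_trans m_le.
apply: le_trans (ler_wpM2l c0 m_le).
by apply: ge_sup => // _ [z /= zr <-]; have /andP[] := fz z zr.
Qed.

Lemma linear_dilatation_le (f : 'rV[R]_n -> 'rV[R]_n) x (c : R) :
  (forall e : R, 0 < e -> exists2 a : R, 0 < a & forall r : R, 0 < r < a ->
     max_stretch f x r / min_stretch f x r <= c + e) ->
  (linear_dilatation f x <= c%:E)%E.
Proof.
move=> H; apply/lee_addgt0Pr => e /H[a a0 fa].
apply: ge_ereal_inf; eexists.
  exists [set r : R | 0 < r < a]; last reflexivity.
  near=> r; apply/andP; split; near: r; first exact: nbhs_right_gt.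
  exact: nbhs_right_lt.
by apply: ge_ereal_sup => _ [r /fa ra <-]; rewrite -EFinD lee_fin.
Unshelve. all: by end_near. Qed.

Lemma small_displacement (G : set 'rV[R]_n) (f : 'rV[R]_n -> 'rV[R]_n) x t :
  open G -> {within G, continuous f} -> G x -> 0 < t ->
  exists2 a : R, 0 < a & forall y, enorm (y - x) < a ->
    G y /\ enorm (f y - f x) < t.
Proof.
move=> Gopen; rewrite continuous_open_subspace // => fcont Gx t0.
have : \forall y \near x, G y /\ enorm (f y - f x) < t.
  apply: filterI; first exact: open_nbhs_nbhs.
  have : (fun y => enorm (f y - f x)) @ x --> enorm (f x - f x).
    apply: (@continuous_comp _ _ _ (fun y => f y - f x)); last first.
      exact: continuous_enorm.
    apply: continuousB; last exact: cst_continuous.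
    by apply: fcont; exact/mem_set.
  rewrite subrr => /cvgr_lt; apply.
  by rewrite -(scale0r 0) /enorm dotprodZl mul0r sqrtr0.
move=> /nbhs_ballP[a /= a0 ba]; exists a => // y ya; apply: ba.
rewrite -ball_normE /= distrC; exact: le_lt_trans (mx_norm_le_enorm _) ya.
Qed.

End Dilatation.

Theorem theorem1p3 (R : realType) (n : nat) (hn : (2 <= n)%N)
    (G1 G2 : set 'rV[R]_n)
    (hG1 : proper_convex_domain G1) (hG2 : proper_convex_domain G2)
    (L : R) (hL : 1 <= L) (f : 'rV[R]_n -> 'rV[R]_n)
    (hf : visual_angle_bilipschitz L G1 G2 f) :
  quasiconformal G1 G2 f /\
  forall x, G1 x -> (linear_dilatation f x <= (4 * L ^+ 2)%:E)%E.
Proof.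
have [fhomeo flip] := hf; have [[fG _ _] fcont _] := fhomeo.
have [G1dom _ _] := hG1; have [G2dom _ _] := hG2.
have [_ G1open _] := G1dom; have [_ G2open _] := G2dom.
suff H x : G1 x -> (linear_dilatation f x <= (4 * L ^+ 2)%:E)%E.
  by split=> //; split=> //; exists (4 * L ^+ 2).
move=> G1x; have G2fx := fG _ G1x.
have [d1 sd1] := exists_supported_at _ _ hG1 G1x.
have [d2 sd2] := exists_supported_at _ _ hG2 G2fx.
have [[d10 _ _] [d20 _ _]] := (sd1, sd2).
have L0 : 0 < L by exact: lt_le_trans hL.
apply: linear_dilatation_le => e e0.
(* 64 L^2 k <= e makes the error factor cost at most e, as
   4 L^2 (1 + 16 k) = 4 L^2 + 64 L^2 k. *)
pose k : R := Num.min 4^-1 (e / (64 * L ^+ 2)).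
have L2 : 0 < L ^+ 2 by rewrite exprn_gt0.
have k0 : 0 < k by rewrite lt_min divr_gt0 ?mulr_gt0 // invr_gt0 ltr0n.
have k14 : k <= 4^-1 by rewrite ge_min lexx.
have ke : 64 * L ^+ 2 * k <= e.
  by rewrite mulrC -ler_pdivlMr ?mulr_gt0 // ge_min lexx orbT.
pose q : R := (1 + k) / (1 - k).
have q0 : 0 < q by rewrite divr_gt0 //; lra.
have q2 : q ^+ 2 <= 1 + 16 * k by apply: ratio_sqr_le; rewrite ltW.
have [a a0 fa] := small_displacement _ _ _ _ G1open fcont G1x (mulr_gt0 k0 d20).
exists (Num.min a (k * d1)) => [|r]; first by rewrite lt_min a0 mulr_gt0.
rewrite lt_min => /and3P[r0 ra rk].
pose C := 2 * L * q.
have C0 : 0 < C by apply: mulr_gt0 => //; apply: mulr_gt0.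
apply: (@le_trans _ _ (C ^+ 2)).
  apply: (stretch_ratio_le _ _ _ _ (d2 / (C * d1) * r)) => //.
  - exact: ltW.
  - by rewrite mulr_gt0 // divr_gt0 // mulr_gt0.
  - exact: sqr_ge0.
  move=> z zr; have [G1z fz] : G1 z /\ enorm (f z - f x) < k * d2.
    by apply: fa; rewrite zr.
  have /andP[flow fup] := flip _ _ G1x G1z.
  have kle : 0 <= k < 1 by rewrite ltW //=; lra.
  have xz : enorm (x - z) = r by rewrite enormB.
  rewrite enormB in fz; rewrite enormB.
  have := displacement_le _ _ _ z _ (f z) _ _ _ _ hn G2open G2fx (fG _ G1z)
    sd1 sd2 kle (ltW L0) _ (ltW fz) fup.
  (* The same estimate for the inverse map, from f z to z. *)
  have := displacement_le _ _ _ (f z) _ z _ _ _ _ hn G1open G1x G1z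
    sd2 sd1 kle (ltW L0) (ltW fz) _ _.
  rewrite xz -/q -/C ltW // => lo up.
  clearbody C q.
  have {}lo : r <= C * (d1 / d2) * enorm (f x - f z).
    by apply: lo => //; rewrite mulrC -ler_pdivrMr.
  apply/andP; split.
    rewrite -(@ler_pM2l _ (C * (d1 / d2))) ?mulr_gt0 ?invr_gt0 //.
    apply: le_trans lo; rewrite le_eqVlt; apply/orP; left; apply/eqP.
    by field; rewrite ?lt0r_neq0.
  apply: le_trans (up isT) _.
  rewrite le_eqVlt; apply/orP; left; apply/eqP.
  by field; rewrite ?lt0r_neq0.
apply: (@le_trans _ _ (4 * L ^+ 2 * (1 + 16 * k))).
  rewrite (_ : C ^+ 2 = 4 * L ^+ 2 * q ^+ 2); last by rewrite /C; ring.
  by rewrite ler_wpM2l // mulr_ge0 // ltW.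
rewrite (_ : _ * (1 + _) = 4 * L ^+ 2 + 64 * L ^+ 2 * k); last by ring.
by rewrite lerD2l.
Qed.
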